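(* Let $0<\alpha\le 1$. There is a dense subset $\mathcal{D}\subset C^{\alpha+}_0(\Sigma^+,\mathbb{R})$ such that any $A\in\mathcal{D}$ has a unique maximizing measure $\mu$ and the pair $(A,\mu)$ has the continuously varying support property.
   Context: $\Sigma^+$ is a one-sided topologically mixing subshift of finite type (the sequences $\mathbf{x}=(x_0,x_1,\ldots)$ over a finite alphabet all of whose consecutive pairs $(x_i,x_{i+1})$ are allowed by a 0-1 transition matrix), with shift map $\sigma:\Sigma^+\to\Sigma^+$. Fix $\lambda>1$ and endow $\Sigma^+$ with the metric $d(\mathbf{x},\mathbf{y})=\lambda^{-n}$, $n=\min\{k\ge 0: x_k\ne y_k\}$ (and $d(\mathbf{x},\mathbf{x})=0$). For an exponent $\alpha$ write $\mathrm{Hold}_\alpha(A)=\sup_{0<d(x,y)\le 1}\frac{|A(x)-A(y)|}{d(x,y)^\alpha}$, $\|A\|_0=\sup_x|A(x)|$, $\|A\|_\alpha=\mathrm{Hold}_\alpha(A)+\|A\|_0$. $C^\alpha(\Sigma^+,\mathbb{R})$ is the space of $\alpha$-Hölder functions $A:\Sigma^+\to\mathbb{R}$ with norm $\|\cdot\|_\alpha$, and $C^\alpha_0(\Sigma^+,\mathbb{R})$ is the subset of those $A$ with topological pressure $P(A)=\max_\nu\big(h(\nu)+\int A\,d\nu\big)=0$, where $\nu$ ranges over $\sigma$-invariant Borel probabilities and $h(\nu)$ is the metric entropy, with the induced topology. $C^{\alpha+}_0(\Sigma^+,\mathbb{R})$ is the closure, in the $\alpha$-Hölder topology, of $\bigcup_{\alpha<\gamma\le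 1}C^\gamma_0(\Sigma^+,\mathbb{R})$ in $C^\alpha_0(\Sigma^+,\mathbb{R})$, with the $\alpha$-Hölder topology. A maximizing measure for $A$ is a $\sigma$-invariant Borel probability $\mu$ with $\int A\,d\mu=\max\{\int A\,d\nu:\nu\ \sigma\text{-invariant Borel probability}\}$. A sequence of probabilities $\nu_n$ strongly converges to $\mu$ if $\nu_n\to\mu$ in the weak* topology and $\mathrm{supp}(\nu_n)\to\mathrm{supp}(\mu)$ in the Hausdorff metric. For $A\in C^\alpha_0(\Sigma^+,\mathbb{R})$ and $\mu$ a maximizing measure for $A$, the pair $(A,\mu)$ has the continuously varying support property if, for every sequence $A_n\to A$ in $C^\alpha_0(\Sigma^+,\mathbb{R})$ and all maximizing measures $\mu_n$ for $A_n$, $\mu_n$ strongly converges to $\mu$. *)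

(* Defs.v *)
From HB Require Import structures.
From mathcomp Require Export all_boot all_order all_algebra.
From mathcomp Require Export all_classical all_reals all_analysis.
From mathcomp Require Import ring.
Export Order.TTheory GRing.Theory Num.Theory.
Export numFieldNormedType.Exports.

Set Implicit Arguments.
Unset Strict Implicit.
Unset Printing Implicit Defensive.

Global Open Scope classical_set_scope.
Global Open Scope ring_scope.

Definition admissible (k : nat) (M : 'M[bool]_k) : set (nat -> 'I_k) :=
  [set x | forall i, M (x i) (x i.+1)].

(* The base [lam] of the metric and a proof that the subshift is nonempty are
   parameters of the type, so that its (pointed, metric, Borel) structures can
   be inferred from it. *)
Definition sft (R : realType) (lam : R) (lam1 : 1 < lam)
    (k : nat) (M : 'M[bool]_k) (ne : admissible M !=set0) : Type :=
  {x : nat -> 'I_k | admissible M x}.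

Section sft_structures.
Context (R : realType) (lam : R) (lam1 : 1 < lam).
Context (k : nat) (M : 'M[bool]_k) (ne : admissible M !=set0).
Notation X := (sft lam1 ne).

HB.instance Definition _ := gen_eqMixin X.
HB.instance Definition _ := gen_choiceMixin X.
HB.instance Definition _ := isPointed.Build X (exist _ _ (svalP (cid ne))).

Definition sft_dist (x y : X) : R :=
  if pselect (exists n, sval x n != sval y n) is left xy
  then lam ^- ex_minn xy else 0.

Lemma sft_distxx x : sft_dist x x = 0.
Proof. rewrite /sft_dist; case: pselect => // xx; exfalso.
by case: xx => n /eqP. Qed.

Lemma sft_eqP (x y : X) : ~ (exists n, sval x n != sval y n) -> x = y.
Proof.
move=> xy; case: x y xy => [x hx] [y hy] /= xy; apply: eq_exist => /=.
apply/funext => n; apply/eqP; apply: contrapT => /negP h.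
by apply: xy; exists n.
Qed.

Let lam0 : 0 < lam. Proof. exact: lt_trans lam1. Qed.

Lemma sft_dist_positivity x y : sft_dist x y = 0 -> x = y.
Proof.
rewrite /sft_dist; case: pselect => [xy /eqP|/sft_eqP//].
by rewrite invr_eq0 expf_eq0 (gt_eqF lam0) andbF.
Qed.

Lemma sft_dist_ge0 x y : 0 <= sft_dist x y.
Proof.
by rewrite /sft_dist; case: pselect => // xy; rewrite invr_ge0 exprn_ge0 // ltW.
Qed.

Lemma sft_dist_le1 x y : sft_dist x y <= 1.
Proof.
rewrite /sft_dist; case: pselect => // xy.
by rewrite invf_le1 ?exprn_gt0// exprn_ege1// ltW.
Qed.

Lemma sft_dist_sym x y : sft_dist x y = sft_dist y x.
Proof.
rewrite /sft_dist; case: pselect => xy; case: pselect => yx //; last 2 first.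
- by case: yx; case: xy => n h; exists n; rewrite eq_sym.
- by case: xy; case: yx => n h; exists n; rewrite eq_sym.
case: ex_minnP => m hm mmin; case: ex_minnP => n hn nmin.
congr (lam ^- _); apply/eqP; rewrite eqn_leq mmin ?nmin// eq_sym//.
Qed.

Lemma sft_dist_triangle y x z : sft_dist x z <= sft_dist x y + sft_dist y z.
Proof.
rewrite {1}/sft_dist; case: pselect => [xz|_]; last first.
  by rewrite addr_ge0 ?sft_dist_ge0.
case: ex_minnP => m hm _.
have key (u v : X) : sval u m != sval v m -> lam ^- m <= sft_dist u v.
  move=> huv; rewrite /sft_dist; case: pselect => [uv|[]]; last by exists m.
  case: ex_minnP => n _ /(_ _ huv) nm.
  rewrite lef_pV2 ?posrE ?exprn_gt0//; exact: ler_weXn2l (ltW lam1) _ _ nm.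
have [xy|xy] := eqVneq (sval x m) (sval y m).
  by rewrite (le_trans (key y z _)) ?lerDr ?sft_dist_ge0// -xy.
by rewrite (le_trans (key x y _)) ?lerDl ?sft_dist_ge0.
Qed.

HB.instance Definition _ := isMetric.Build R X sft_distxx
  sft_dist_positivity sft_dist_sym sft_dist_triangle.

HB.instance Definition _ := @isMeasurable.Build (sigma_display (@open X)) X
  <<s @open X >> (@sigma_algebra0 _ setT _) (@sigma_algebraC X _)
  (@sigma_algebra_bigcup _ setT _).

Definition shift (x : X) : X :=
  exist (admissible M) (fun i => sval x i.+1) (fun i => svalP x i.+1).

End sft_structures.

Arguments shift {R lam lam1 k M ne} x.

Definition topologically_mixing (T : topologicalType) (f : T -> T) : Prop :=
  forall U V : set T, open U -> open V -> U !=set0 -> V !=set0 ->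
    exists N : nat, forall n, (N <= n)%N -> U `&` (iter n f @^-1` V) !=set0.

Section holder.
Context (R : realType) (lam : R) (lam1 : 1 < lam).
Context (k : nat) (M : 'M[bool]_k) (ne : admissible M !=set0).
Notation X := (sft lam1 ne).
Implicit Types (alpha : R) (A : X -> R).

Definition holder_quotients alpha A : set R :=
  [set r | exists x y : X, [/\ 0 < mdist x y, mdist x y <= 1 &
     r = `|A x - A y| / mdist x y `^ alpha]].

(* For [alpha > 0] the second condition follows from the first, [X] having
   diameter at most 1; it makes [holder_norm] finite for every [alpha]. *)
Definition is_holder alpha A : Prop :=
  has_ubound (holder_quotients alpha A) /\ has_ubound (range (fun x => `|A x|)).

(* When [X] is a single point there is no quotient, and [sup set0 = 0]. *)
Definition Hold alpha A : R := sup (holder_quotients alpha A).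

Definition norm0 A : R := sup (range (fun x => `|A x|)).

Definition holder_norm alpha A : R := Hold alpha A + norm0 A.

Definition holder_space alpha : Type := {A : X -> R | is_holder alpha A}.

Definition holder_fun alpha (A : holder_space alpha) : X -> R := sval A.

End holder.

Arguments holder_space {R lam} lam1 {k M} ne alpha.
Coercion holder_fun : holder_space >-> Funclass.

Section holder_metric.
Context (R : realType) (lam : R) (lam1 : 1 < lam).
Context (k : nat) (M : 'M[bool]_k) (ne : admissible M !=set0) (alpha : R).
Notation X := (sft lam1 ne).
Notation H := (holder_space lam1 ne alpha).

HB.instance Definition _ := gen_eqMixin H.
HB.instance Definition _ := gen_choiceMixin H.

Let sup_le (S : set R) (C : R) : 0 <= C -> ubound S C -> sup S <= C.
Proof.
move=> C0 SC; have [->|/set0P S0] := eqVneq S set0; first by rewrite sup0.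
exact: ge_sup.
Qed.

Let Hold_ge0 (A : X -> R) : 0 <= Hold alpha A.
Proof.
rewrite /Hold; have [[[r Sr] Sub]|/sup_out->//] :=
  pselect (has_sup (holder_quotients alpha A)).
apply: le_trans (ub_le_sup Sub Sr).
by case: Sr => x [y [_ _ ->]]; rewrite divr_ge0 ?powR_ge0.
Qed.

Let norm0_ub (A : X -> R) x : is_holder alpha A -> `|A x| <= norm0 A.
Proof. by move=> [_ hA]; apply: ub_le_sup => //; exists x. Qed.

Let norm0_ge0 (A : X -> R) : is_holder alpha A -> 0 <= norm0 A.
Proof. by move=> hA; apply: le_trans (norm0_ub point hA). Qed.

Let is_holderB (A B : X -> R) : is_holder alpha A -> is_holder alpha B ->
  is_holder alpha (fun x => A x - B x).
Proof.
move=> [[a ha] [a' ha']] [[b hb] [b' hb']]; split; last first.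
  exists (a' + b') => _ [x _ <-]; rewrite (le_trans (ler_normB _ _))// lerD//.
    by apply: ha'; exists x.
  by apply: hb'; exists x.
exists (a + b) => _ [x [y [d0 d1 ->]]].
apply: (@le_trans _ _ (`|A x - A y| / mdist x y `^ alpha +
                       `|B x - B y| / mdist x y `^ alpha)); last first.
  by apply: lerD; [apply: ha | apply: hb]; exists x, y.
rewrite -mulrDl ler_wpM2r ?invr_ge0 ?powR_ge0//.
rewrite (_ : _ - _ = (A x - A y) - (B x - B y)) ?ler_normB//; ring.
Qed.

Let Hold_triangle (A B C : X -> R) : is_holder alpha A -> is_holder alpha B ->
  (forall x, C x = A x + B x) -> holder_norm alpha C <=
    holder_norm alpha A + holder_norm alpha B.
Proof.
move=> hA hB CE; rewrite /holder_norm addrACA; apply: lerD; last first.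
  apply: sup_le; first by rewrite addr_ge0// norm0_ge0.
  move=> _ [x _ <-]; rewrite CE (le_trans (ler_normD _ _))//.
  by rewrite lerD// norm0_ub.
apply: sup_le; first by rewrite addr_ge0// Hold_ge0.
move=> _ [x [y [d0 d1 ->]]].
apply: (@le_trans _ _ (`|A x - A y| / mdist x y `^ alpha +
                       `|B x - B y| / mdist x y `^ alpha)); last first.
  by apply: lerD; apply: ub_le_sup; [case: hA| |case: hB|]; rewrite //;
    exists x, y.
rewrite -mulrDl ler_wpM2r ?invr_ge0 ?powR_ge0// !CE.
by rewrite opprD addrACA ler_normD.
Qed.

Definition holder_dist (A B : H) : R := holder_norm alpha (fun x => A x - B x).

Lemma holder_distxx (A : H) : holder_dist A A = 0.
Proof.
apply/eqP; rewrite eq_le; apply/andP; split; last first.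
  by rewrite addr_ge0 ?Hold_ge0 ?norm0_ge0//; apply: is_holderB; exact: svalP.
rewrite /holder_dist /holder_norm -(addr0 0); apply: lerD; apply: sup_le => //.
  by move=> _ [x [y [_ _ ->]]]; rewrite !subrr normr0 mul0r.
by move=> _ [x _ <-]; rewrite subrr normr0.
Qed.

Lemma holder_dist_positivity (A B : H) : holder_dist A B = 0 -> A = B.
Proof.
have hAB := is_holderB (svalP A) (svalP B).
move=> AB; have n0 : norm0 (fun x => A x - B x) <= 0.
  by rewrite -AB lerDr Hold_ge0.
have {AB} AB x : A x = B x.
  apply/eqP; rewrite -subr_eq0 -normr_le0.
  exact: le_trans (norm0_ub x hAB) n0.
case: A B AB {hAB n0} => [A hA] [B hB] /= AB; apply: eq_exist.
exact/funext.
Qed.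

Lemma holder_dist_sym (A B : H) : holder_dist A B = holder_dist B A.
Proof.
rewrite /holder_dist /holder_norm /Hold /norm0; congr (sup _ + _).
  apply/seteqP; split => _ [x [y [d0 d1 ->]]];
    exists x, y; split=> //; congr (_ / _); rewrite -normrN; congr (`|_|); ring.
by under eq_fun do rewrite distrC.
Qed.

Lemma holder_dist_triangle (B A C : H) :
  holder_dist A C <= holder_dist A B + holder_dist B C.
Proof.
apply: (@Hold_triangle (fun x => A x - B x) (fun x => B x - C x)) => [||x];
  try by apply: is_holderB; exact: svalP.
by rewrite addrA subrK.
Qed.

HB.instance Definition _ := isMetric.Build R H holder_distxx
  holder_dist_positivity holder_dist_sym holder_dist_triangle.

End holder_metric.

Section thermodynamics.
Context (R : realType) (lam : R) (lam1 : 1 < lam).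
Context (k : nat) (M : 'M[bool]_k) (ne : admissible M !=set0).
Notation X := (sft lam1 ne).
Implicit Types (mu nu : probability X R) (A : X -> R).

Definition shift_invariant nu : Prop :=
  forall B : set X, measurable B -> nu (shift @^-1` B) = nu B.

(* A finite measurable partition with (possibly empty) atoms indexed by ['I_m]
   is encoded as the map [xi] sending a point to the index of its atom. *)
Definition measurable_partition (m : nat) (xi : X -> 'I_m) : Prop :=
  forall i, measurable (xi @^-1` [set i]).

(* As [w] varies, [refined_atom xi w] ranges over the atoms of the join of the
   [shift^-i xi], [i < n]. *)
Definition refined_atom (m : nat) (xi : X -> 'I_m) (n : nat)
    (w : {ffun 'I_n -> 'I_m}) : set X :=
  [set x | forall i : 'I_n, xi (iter i shift x) = w i].

(* The convention [0 * ln 0 = 0] holds since [ln 0 = 0]. *)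
Definition refined_entropy nu (m : nat) (xi : X -> 'I_m) (n : nat) : R :=
  - \sum_(w : {ffun 'I_n -> 'I_m})
      fine (nu (refined_atom xi w)) * ln (fine (nu (refined_atom xi w))).

Definition partition_entropy nu (m : nat) (xi : X -> 'I_m) : R :=
  lim (refined_entropy nu xi n / n%:R @[n --> \oo]).

Definition entropy nu : \bar R :=
  ereal_sup [set h | exists (m : nat) (xi : X -> 'I_m),
    measurable_partition xi /\ h = (partition_entropy nu xi)%:E].

(* The supremum is a maximum, entropy being upper semicontinuous on [X]. *)
Definition pressure A : \bar R :=
  ereal_sup [set (entropy nu + (\int[nu]_x A x)%:E)%E | nu in shift_invariant].

Definition maximizing A mu : Prop :=
  shift_invariant mu /\
  forall nu, shift_invariant nu -> \int[nu]_x A x <= \int[mu]_x A x.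

Definition supp nu : set X :=
  [set x | forall U : set X, open U -> U x -> (0 < nu U)%E].

Definition hausdorff_dist (K L : set X) : R :=
  Num.max (sup [set inf [set mdist x y | y in L] | x in K])
          (sup [set inf [set mdist x y | x in K] | y in L]).

Definition strongly_converges (nu : nat -> probability X R) mu : Prop :=
  (forall f : X -> R, continuous f ->
     \int[nu n]_x f x @[n --> \oo] --> \int[mu]_x f x) /\
  hausdorff_dist (supp (nu n)) (supp mu) @[n --> \oo] --> (0 : R).

End thermodynamics.

Section holder_pressure0.
Context (R : realType) (lam : R) (lam1 : 1 < lam).
Context (k : nat) (M : 'M[bool]_k) (ne : admissible M !=set0) (alpha : R).
Notation X := (sft lam1 ne).
Notation H := (holder_space lam1 ne alpha).

Definition C0 : set H := [set A | pressure A = 0%E].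

(* For [alpha < gamma], a [gamma]-Hoelder function on [X] is [alpha]-Hoelder, so
   [C0_higher gamma] is the whole [gamma]-Hoelder class of zero pressure, seen
   inside the [alpha]-Hoelder space. *)
Definition C0_higher (gamma : R) : set H :=
  [set A | is_holder gamma A /\ pressure A = 0%E].

Definition C0plus : set H :=
  C0 `&` closure (\bigcup_(gamma in [set g | alpha < g <= 1]) C0_higher gamma).

Definition continuously_varying_support (A : H) (mu : probability X R) : Prop :=
  forall An : nat -> H, (forall n, C0 (An n)) -> An n @[n --> \oo] --> A ->
  forall mun : nat -> probability X R, (forall n, maximizing (An n) (mun n)) ->
    strongly_converges mun mu.

End holder_pressure0.

Arguments C0plus {R lam} lam1 {k M} ne alpha.

(* Main.v *)
From HB Require Import structures.
Require Import Defs.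
From mathcomp Require Import measurable_realfun ring lra.

Set Implicit Arguments.
Unset Strict Implicit.
Unset Printing Implicit Defensive.

(** The set [D] consists of the potentials of C^{alpha+}_0 that enjoy the two
    conclusions, so that density is the only issue: arbitrarily close to a given
    potential there must be one whose maximizing measure is locked, that is,
    unique and shared by all potentials that are close in the alpha-Hölder norm.
    For a locked potential, maximizing measures of nearby potentials are
    eventually equal to the limit measure, a fortiori strongly convergent to it.

    By definition of C^{alpha+}_0, the given potential may be assumed
    gamma-Hölder with gamma > alpha. The gain in the exponent makes it a limit,
    in alpha-Hölder norm, of functions [f] that depend on finitely many letters
    ([holder_approx_locally_constant]). Such an [f] is a weight on the vertices
    of a finite graph of words, whose infinite paths are the points of the
    subshift. Removing loops from a path shows that some simple cycle [c] has
    maximal mean weight [m] and that a path of [n] vertices weighs at most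
    [m n + K] ([max_mean_cycle]). Charging a small penalty [eps] at the points
    that do not follow an edge of [c] gives a locally constant function whose
    Birkhoff sums are at most [m n + K - eps s], where [s] counts the passages
    through such stray points.

    Let now [F] be a perturbation of alpha-Hölder norm at most [e]. While an
    orbit does not stray, it shadows the periodic orbit of [c], and exponentially
    well away from the end of the segment, so the Birkhoff sum of [F] exceeds
    that of the periodic orbit by at most a constant times [e]
    ([shadowing_sum], [birkhoff_follows]). The orbit can thus gain a multiple of
    [e] per stray point ([birkhoff_le]), which the penalty outweighs when [e] is
    small compared to [eps]. Integrating the resulting bound against an invariant
    measure and dividing by [n] yields [locking_integral_le]: an invariant
    measure loses at least [eps / 2] times the mass of the stray points against
    the measure on the periodic orbit. A maximizing measure therefore gives no
    mass to stray points, so it is carried by the periodic orbit and is the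
    measure equidistributed on it ([invariant_stray0_unique]).

    It remains to return to zero pressure. The pressure is 1-Lipschitz for the
    uniform norm and commutes with the addition of constants; its finiteness is
    inherited from the potential being approximated. Hence subtracting the
    pressure moves the function by at most its uniform distance to that
    potential, and locking is insensitive to constants
    ([pressure_normalization], [locked_approximation]). *)

(** * Cycles of maximal mean weight in a finite graph *)

Lemma seq_argmax (R : realType) (T : eqType) (F : T -> R) (L : seq T) :
  L != [::] -> exists2 x, x \in L & {in L, forall y, F y <= F x}.
Proof.
elim: L => // a [|b L] IH _.
  by exists a; rewrite ?mem_head// => y; rewrite inE => /eqP->.
have [//|x xL xmax] := IH _; have [ax|xa] := leP (F a) (F x).
  exists x; first by rewrite inE xL orbT.
  by move=> y; rewrite inE => /predU1P[->//|]; exact: xmax.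
exists a; first exact: mem_head.
move=> y; rewrite inE => /predU1P[->//|/xmax/le_trans]; apply; exact: ltW.
Qed.

(** Cutting at the last vertex that occurs again leaves a loop without
    repetition, i.e. a simple cycle, and a shorter path. *)
Lemma first_loop (T : eqType) (s : seq T) : ~~ uniq s ->
  exists s1 x s2 s3, s = s1 ++ x :: s2 ++ x :: s3 /\ uniq (x :: s2).
Proof.
elim: s => //= a s IH; rewrite negb_and negbK.
have [us|/IH[s1 [x [s2 [s3 [-> us]]]]] _] := boolP (uniq s); last first.
  by exists (a :: s1), x, s2, s3.
rewrite orbF => asn; case/splitPr: asn us => p1 p2 us.
exists [::], a, p1, p2; split=> //=; move: us.
rewrite cat_uniq /= => /and3P[-> + _].
by rewrite negb_or => /andP[->].
Qed.

Lemma sorted_loop (T : Type) (E : rel T) s1 x s2 s3 :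
  sorted E (s1 ++ x :: s2 ++ x :: s3) ->
  sorted E (s1 ++ x :: s3) /\ cycle E (x :: s2).
Proof.
have loop : path E x (s2 ++ x :: s3) -> path E x s3 /\ path E x (rcons s2 x).
  by rewrite cat_path rcons_path /= => /and3P[-> ->].
case: s1 => [|a s1] /=; first exact: loop.
by rewrite !cat_path /= => /and3P[-> -> /loop[-> ->]].
Qed.

(** There are finitely many simple cycles; [c] is one of maximal mean [m]. A path
    without repetition has bounded weight, which [K] absorbs. From any other path
    a simple loop can be cut out: the loop weighs at most [m] per vertex, and what
    remains is again a path. The path [s0] serves to provide a first cycle. *)
Lemma max_mean_cycle (R : realType) (V : finType) (E : rel V) (g : V -> R)
    (s0 : seq V) : sorted E s0 -> ~~ uniq s0 ->
  exists (c : seq V) (m K : R), [/\ c != [::], uniq c, cycle E c,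
    \sum_(v <- c) g v = m *+ size c &
    forall s, sorted E s -> \sum_(v <- s) g v <= m *+ size s + K].
Proof.
move=> s0E s0u.
pose loop (c : seq V) := [&& c != [::], uniq c & cycle E c].
pose L := [seq c <- flatten [seq map val (enum {: q.-tuple V})
                            | q <- iota 0 #|V|.+1] | loop c].
have inL c : loop c -> c \in L.
  move=> lc; rewrite mem_filter lc andTb; apply/flatten_mapP.
  exists (size c).
    rewrite mem_iota /= add0n ltnS.
    by case/and3P: lc => _ /card_uniqP <- _; exact: max_card.
  apply/mapP; exists (in_tuple c) => //; exact: mem_enum.
pose mean (c : seq V) := (\sum_(v <- c) g v) / (size c)%:R.
have L0 : L != [::].
  have [s1 [x [s2 [s3 [s0E' us]]]]] := first_loop s0u.
  have [_ cE] := sorted_loop (eq_ind _ (sorted E) s0E _ s0E').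
  have : x :: s2 \in L by apply: inL; rewrite /loop us cE.
  by apply: contraTneq => ->.
have [c cL cmax] := seq_argmax mean L0.
have /and3P[c0 uc cE] : loop c by move: cL; rewrite mem_filter => /andP[].
have size0 (s : seq V) : s != [::] -> (0 : R) < (size s)%:R.
  by rewrite ltr0n lt0n size_eq0.
have loop_le s : loop s -> \sum_(v <- s) g v <= mean c *+ size s.
  move=> ls; have s_n0 : s != [::] by case/and3P: ls.
  rewrite -mulr_natr -ler_pdivrMr ?size0//; exact: cmax (inL _ ls).
pose G := \sum_v `|g v|.
have gG v : g v <= G.
  rewrite (le_trans (ler_norm _))// /G (bigD1 v)//= lerDl.
  by apply: sumr_ge0 => *.
exists c, (mean c), ((G + `|mean c|) *+ #|V|); split => //.
  by rewrite -mulr_natr divfK// gt_eqF// size0.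
have G0 : 0 <= G by apply: sumr_ge0 => *.
move=> s; have [n] := ubnP (size s); elim: n s => // n IH s sn sE.
have [us|/first_loop[s1 [x [s2 [s3 [sE' us]]]]]] := boolP (uniq s).
  have sV : (size s <= #|V|)%N by rewrite -(card_uniqP us) max_card.
  have le1 (t : seq V) : \sum_(v <- t) g v <= G *+ size t.
    elim: t => [|v t IHt]; rewrite ?big_nil// big_cons mulrS.
    by rewrite lerD.
  have le2 : (G + `|mean c|) *+ size s <= (G + `|mean c|) *+ #|V|.
    by apply: ler_wpMn2l => //; exact: addr_ge0.
  have le3 : 0 <= (mean c + `|mean c|) *+ size s.
    have := ler_norm (- mean c); rewrite normrN => ?.
    by rewrite mulrn_wge0//; lra.
  rewrite (le_trans (le1 _))//; move: le2 le3; rewrite !mulrnDl; lra.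
have [s13 cs] := sorted_loop (eq_ind _ (sorted E) sE _ sE').
have := IH (s1 ++ x :: s3) _ s13.
have := loop_le (x :: s2); rewrite /loop us cs => /(_ isT).
rewrite sE' !big_cat !big_cons !big_cat/= !big_cons !size_cat/= !size_cat/=.
move=> h1 h2.
have sE2 : (size s1 + (size s2 + (size s3).+1).+1 =
    (size s2).+1 + (size s1 + (size s3).+1))%N.
  by rewrite addnS addnA addnAC addnC addSn.
have {}h2 := h2 _; rewrite sE2 mulrnDr.
have /h2 : (size s1 + (size s3).+1 < n)%N.
  move: sn; rewrite ltnS sE' size_cat/= size_cat/= sE2.
  by apply: leq_trans; rewrite addSn ltnS leq_addl.
lra.
Qed.

(** * Integrals of bounded measurable functions *)

(** Integrability is automatic for bounded measurable functions and a probability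
    measure, so that all the linearity rules below hold without side conditions
    on integrals. *)
Section bounded_measurable.
Context d (T : measurableType d) (R : realType).
Implicit Types (f g : T -> R) (nu : probability T R).

Definition bounded_mfun f := measurable_fun setT f /\ exists C, forall x, `|f x| <= C.

Lemma bounded_mfun_cst c : bounded_mfun (cst c).
Proof. by split; [exact: measurable_cst|exists `|c|]. Qed.

Lemma bounded_mfunD f g : bounded_mfun f -> bounded_mfun g ->
  bounded_mfun (fun x => f x + g x).
Proof.
move=> [mf [a fa]] [mg [b gb]]; split; first exact: measurable_funD.
by exists (a + b) => x; rewrite (le_trans (ler_normD _ _))// lerD.
Qed.

Lemma bounded_mfunZ c f : bounded_mfun f -> bounded_mfun (fun x => c * f x).
Proof.
move=> [mf [a fa]]; split.
  by apply: measurable_funM => //; exact: measurable_cst.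
by exists (`|c| * a) => x; rewrite normrM ler_wpM2l.
Qed.

Lemma bounded_mfun_indic (A : set T) : measurable A -> bounded_mfun (\1_A).
Proof.
move=> mA; split; first exact: measurable_indic.
by exists 1 => x; rewrite indicE ger0_norm ?ler0n// lern1 leq_b1.
Qed.

Lemma bounded_mfun_sum (F : nat -> T -> R) n : (forall i, bounded_mfun (F i)) ->
  bounded_mfun (fun x => \sum_(i < n) F i x).
Proof.
move=> bF; elim: n => [|n IH].
  by under eq_fun do rewrite big_ord0; exact: bounded_mfun_cst.
by under eq_fun do rewrite big_ord_recr; exact: bounded_mfunD.
Qed.

Lemma bounded_mfun_integrable nu f : bounded_mfun f -> nu.-integrable setT (EFin \o f).
Proof.
move=> [mf [C fC]]; apply: measurable_bounded_integrable => //.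
  by rewrite (le_lt_trans (probability_le1 _ _)) ?ltry.
exists C; split; first exact: num_real.
by move=> D CD x _; apply: le_trans (fC x) (ltW CD).
Qed.

Lemma bounded_mfun_le_integral nu f g :
  bounded_mfun f -> bounded_mfun g -> (forall x, f x <= g x) ->
  \int[nu]_x f x <= \int[nu]_x g x.
Proof. by move=> bf bg fg; apply: le_Rintegral => //; exact: bounded_mfun_integrable. Qed.

Lemma bounded_mfun_integralD nu f g : bounded_mfun f -> bounded_mfun g ->
  \int[nu]_x (f x + g x) = \int[nu]_x f x + \int[nu]_x g x.
Proof. by move=> bf bg; apply: RintegralD => //; exact: bounded_mfun_integrable. Qed.

Lemma bounded_mfun_integralZ nu c f : bounded_mfun f ->
  \int[nu]_x (c * f x) = c * \int[nu]_x f x.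
Proof. by move=> bf; apply: RintegralZl => //; exact: bounded_mfun_integrable. Qed.

Lemma bounded_mfun_integral_cst nu c : \int[nu]_x c = c.
Proof.
rewrite Rintegral_cst// -[RHS]mulr1; congr (_ * _).
by rewrite -[RHS]/(fine 1%E); congr fine; exact: probability_setT.
Qed.

Lemma bounded_mfun_integral_sum nu (F : nat -> T -> R) n :
  (forall i, bounded_mfun (F i)) ->
  \int[nu]_x (\sum_(i < n) F i x) = \sum_(i < n) \int[nu]_x F i x.
Proof.
move=> bF; elim: n => [|n IH].
  rewrite big_ord0; under eq_Rintegral do rewrite big_ord0.
  exact: bounded_mfun_integral_cst.
under eq_Rintegral do rewrite big_ord_recr.
rewrite bounded_mfun_integralD//; last exact: bounded_mfun_sum.
by rewrite big_ord_recr/= IH.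
Qed.

Lemma integral_indic_prob nu (A : set T) : measurable A ->
  \int[nu]_x \1_A x = fine (nu A).
Proof. by move=> mA; rewrite /Rintegral integral_indic// setIT. Qed.

Section invariant.
Variables (f : T -> T) (mf : measurable_fun setT f).
Variables (nu : probability T R).
Hypothesis inv : forall B, measurable B -> nu (f @^-1` B) = nu B.

Lemma bounded_mfun_comp g : bounded_mfun g -> bounded_mfun (g \o f).
Proof.
move=> [mg [C gC]]; split; first exact: measurableT_comp.
by exists C => x; exact: gC.
Qed.

Lemma bounded_mfun_iter g n : bounded_mfun g -> bounded_mfun (fun x => g (iter n f x)).
Proof.
move=> bg; elim: n => // n IH; under eq_fun do rewrite iterSr.
exact: (bounded_mfun_comp IH).
Qed.

Lemma invariant_integral g : bounded_mfun g -> \int[nu]_x g (f x) = \int[nu]_x g x.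
Proof.
move=> bg; rewrite /Rintegral; congr fine.
transitivity (\int[pushforward nu f]_x (g x)%:E)%E; last first.
  by apply: eq_measure_integral => A mA _; exact: inv.
rewrite (integral_pushforward mf)//=.
  by apply/measurable_EFinP; case: bg.
exact: (bounded_mfun_integrable nu (bounded_mfun_comp bg)).
Qed.

Lemma invariant_integral_iter g n : bounded_mfun g ->
  \int[nu]_x g (iter n f x) = \int[nu]_x g x.
Proof.
move=> bg; elim: n => // n IH; under eq_Rintegral do rewrite iterSr.
rewrite -[RHS]IH; exact: (invariant_integral (bounded_mfun_iter n bg)).
Qed.

Lemma invariant_integral_birkhoff g n : bounded_mfun g ->
  \int[nu]_x (\sum_(i < n) g (iter i f x)) = n%:R * \int[nu]_x g x.
Proof.
move=> bg; rewrite (bounded_mfun_integral_sum nu n (fun i => bounded_mfun_iter i bg)).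
under eq_bigr do rewrite invariant_integral_iter//.
by rewrite sumr_const card_ord mulr_natl.
Qed.

End invariant.
End bounded_measurable.

Section equidistribution.
Context d (T : measurableType d) (R : realType).
Variables (x0 : T) (s : seq T).

Let mass (i : nat) : {measure set T -> \bar R} := \d_(nth x0 s i).

(** The average of the Dirac masses at the entries of [s]; [x0] is only the
    default value of [nth]. *)
Definition equidistribution : set T -> \bar R :=
  mscale ((size s)%:R^-1)%:nng (msum mass (size s)).

HB.instance Definition _ := Measure.on equidistribution.

Lemma equidistributionE (B : set T) :
  equidistribution B = ((\sum_(x <- s) \1_B x) / (size s)%:R)%:E.
Proof.
rewrite /equidistribution /mscale/= /msum (big_nth x0) big_mkord.
rewrite (eq_bigr (fun i : 'I_(size s) => (\1_B (nth x0 s i) : R)%:E)).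
  by rewrite sumEFin -EFinM mulrC.
by move=> i _; rewrite indicE; exact: diracE.
Qed.

Hypothesis s0 : s != [::].

Let size_gt0 : (0 : R) < (size s)%:R.
Proof. by rewrite ltr0n lt0n size_eq0. Qed.

Lemma equidistribution_setT : equidistribution setT = 1%E.
Proof.
rewrite equidistributionE (eq_bigr (fun=> 1)); last first.
  by move=> x _; rewrite indicT.
by rewrite big_const_seq count_predT iter_addr_0 divff// gt_eqF.
Qed.

HB.instance Definition _ :=
  Measure_isProbability.Build _ _ _ equidistribution equidistribution_setT.

Definition equidistribution_prob : probability T R := equidistribution.

Lemma integral_equidistribution f : bounded_mfun f ->
  \int[equidistribution_prob]_x f x = (\sum_(x <- s) f x) / (size s)%:R.
Proof.
move=> bf; have [mf [C fC]] := bf; have bC := @bounded_mfun_cst _ T R C.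
(* the integral formulas for sums and multiples of measures concern nonnegative
   functions, whence the translation by a bound [C] of [f] *)
suff fD : \int[equidistribution_prob]_x (f x + C) =
    (\sum_(x <- s) (f x + C)) / (size s)%:R.
  move: fD; rewrite (bounded_mfun_integralD _ bf bC) bounded_mfun_integral_cst.
  rewrite big_split/= big_const_seq count_predT iter_addr_0 mulrDl.
  by rewrite -[C *+ _]mulr_natr mulfK ?gt_eqF// => /addIr.
have fC0 x : 0 <= f x + C.
  by have := ler_norm (- f x); rewrite normrN; have := fC x; lra.
have mfC : measurable_fun setT (EFin \o (fun x => f x + C)).
  by apply/measurable_EFinP; case: (bounded_mfunD bf bC).
rewrite /Rintegral ge0_integral_mscale//; last by move=> x _; rewrite lee_fin.
rewrite ge0_integral_measure_sum//; last by move=> x _; rewrite lee_fin.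
rewrite (eq_bigr (fun i : 'I_(size s) => (f (nth x0 s i) + C)%:E)); last first.
  by move=> i _; rewrite integral_dirac// diracT mul1e.
by rewrite sumEFin/= mulrC [in RHS](big_nth x0) big_mkord.
Qed.

End equidistribution.

(** * The metric of the subshift and its Hölder functions *)

Section sft_metric.
Context (R : realType) (lam : R) (lam1 : 1 < lam).
Context (k : nat) (M : 'M[bool]_k) (ne : admissible M !=set0).
Notation X := (sft lam1 ne).
Implicit Types (x y : X) (A : X -> R) (a b c g e : R).

Definition agree n x y := forall i, (i < n)%N -> sval x i = sval y i.

Lemma agree_sym n x y : agree n x y -> agree n y x.
Proof. by move=> xy i /xy. Qed.

Lemma agree_trans n x y z : agree n x y -> agree n y z -> agree n x z.
Proof. by move=> xy yz i ni; rewrite xy ?yz. Qed.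

Let lam0 : 0 < lam. Proof. exact: lt_trans lam1. Qed.

Lemma mdist_first_difference x y : x != y ->
  exists m, [/\ sval x m != sval y m, agree m x y & mdist x y = lam ^- m].
Proof.
move=> xy; rewrite [mdist x y]/(sft_dist x y) /sft_dist.
case: pselect => [exy|/sft_eqP/eqP]; last by rewrite (negPf xy).
case: ex_minnP => m hm mmin; exists m; split=> // i im.
by apply: contraTeq im => /mmin; rewrite -leqNgt.
Qed.

Lemma mdist_leP n x y : mdist x y <= lam ^- n <-> agree n x y.
Proof.
have [->|/mdist_first_difference[m [xym ag ->]]] := eqVneq x y.
  by rewrite mdistxx invr_ge0 exprn_ge0 ?ltW//; split.
rewrite lef_pV2 ?posrE ?exprn_gt0// ler_eXn2l//; split=> [nm i im|agn].
  by apply: ag; exact: leq_trans im nm.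
by rewrite leqNgt; apply/negP => /agn; apply/eqP.
Qed.

Lemma mdist_le1 x y : mdist x y <= 1.
Proof. by rewrite -invr1 -(expr0 lam); apply/mdist_leP. Qed.

Lemma mdist_shift x y : mdist (shift x) (shift y) <= lam * mdist x y.
Proof.
have [<-|/mdist_first_difference[[|m] [_ ag xyE]]] := eqVneq x y.
- by rewrite !mdistxx mulr0.
- by rewrite xyE expr0 invr1 mulr1 (le_trans (mdist_le1 _ _))// ltW.
have -> : lam * mdist x y = lam ^- m.
  by rewrite xyE exprS invfM mulrA mulfV ?mul1r// gt_eqF.
by apply/mdist_leP => i im; exact: ag.
Qed.

Lemma continuous_shift : continuous (shift : X -> X).
Proof.
move=> x U /nbhs_ballP[e /= e0 eU]; apply/nbhs_ballP.
exists (e / lam); first exact: divr_gt0.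
move=> y xy; apply: eU; move: xy; rewrite !ballEmdist/= => xy.
by rewrite (le_lt_trans (mdist_shift _ _))// mulrC -ltr_pdivlMr.
Qed.

Lemma open_measurable_sft (U : set X) : open U -> measurable U.
Proof. exact: sub_sigma_algebra. Qed.

Lemma measurable_shift : measurable_fun setT (shift : X -> X).
Proof.
apply: (@measurability _ _ X X _ _ (@open X)) => // _ [U oU <-].
rewrite setTI; apply: open_measurable_sft.
by move/continuousP: continuous_shift; apply.
Qed.

Lemma continuous_measurable A : continuous A -> measurable_fun setT A.
Proof.
move=> /continuousP cA; apply: (measurability _ (RGenOpens.measurableE R)).
move=> _ [_ [a [b ->] <-]]; rewrite setTI; apply: open_measurable_sft.
exact/cA/interval_open.
Qed.

(** Unlike the Hölder quotient, this form of the Hölder condition needs no case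
    distinction for [x = y]. *)
Definition holder_bound g A c := forall x y, `|A x - A y| <= c * mdist x y `^ g.

Lemma holder_bound_continuous g A c : 0 < g -> holder_bound g A c -> continuous A.
Proof.
move=> g0 hA x U /nbhs_ballP[e /= e0 eU]; pose c1 := Num.max c 1.
have c10 : 0 < c1 by rewrite lt_max ltr01 orbT.
apply/nbhs_ballP; exists ((e / c1) `^ g^-1).
  by rewrite /= powR_gt0 ?divr_gt0.
rewrite ballEmdist => y /= xy; apply: eU; rewrite /ball/=.
rewrite (le_lt_trans (hA _ _))//.
rewrite (@le_lt_trans _ _ (c1 * mdist x y `^ g))//.
  by rewrite ler_wpM2r ?powR_ge0// le_max lexx.
rewrite mulrC -ltr_pdivlMr//.
have := @gt0_ltr_powR _ g g0 (mdist x y) ((e/c1) `^ g^-1).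
rewrite -powRrM mulVf ?gt_eqF// powRr1 ?divr_ge0 ?ltW//; apply=> //.
  by rewrite nnegrE mdist_ge0.
by rewrite nnegrE powR_ge0.
Qed.

Lemma holder_bound_bmf g A c : 0 < g -> holder_bound g A c -> bounded_mfun A.
Proof.
move=> g0 hA; split.
  exact: continuous_measurable (holder_bound_continuous g0 hA).
exists (`|A point| + `|c|) => x.
have -> : A x = A point + (A x - A point) by rewrite addrC subrK.
rewrite (le_trans (ler_normD _ _))// lerD2l (le_trans (hA _ _))//.
rewrite (@le_trans _ _ (`|c| * mdist x point `^ g))//.
  by rewrite ler_wpM2r ?powR_ge0// ler_norm.
rewrite -[leRHS]mulr1 ler_wpM2l//.
have := @ge0_ler_powR R g (ltW g0) (mdist x point) 1; rewrite powR1.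
by apply; rewrite ?nnegrE ?mdist_ge0 ?mdist_le1 ?ler01.
Qed.

Lemma is_holder_bound g A : 0 < g -> is_holder g A ->
  exists2 c, 0 <= c & holder_bound g A c.
Proof.
move=> g0 [[c hc] _]; exists `|c| => // x y.
have [->|xy] := eqVneq x y.
  by rewrite subrr normr0 mulr_ge0// powR_ge0.
rewrite -ler_pdivrMr ?powR_gt0 ?mdist_gt0//.
rewrite (le_trans _ (ler_norm c))//; apply: hc; exists x, y; split=> //.
  by rewrite mdist_gt0.
exact: mdist_le1.
Qed.

Lemma holder_bound_is_holder g A c b : holder_bound g A c -> (forall x, `|A x| <= b) ->
  is_holder g A.
Proof.
move=> hA Ab; split; last by exists b => _ [x _ <-].
exists c => _ [x [y [d0 d1 ->]]].
by rewrite ler_pdivrMr ?powR_gt0.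
Qed.

Lemma holder_boundB (g a b : R) (A B : X -> R) :
  holder_bound g A a -> holder_bound g B b ->
  holder_bound g (fun x => A x - B x) (a + b).
Proof.
move=> hA hB x y; rewrite (_ : _ - _ = (A x - A y) - (B x - B y)); last by ring.
by rewrite (le_trans (ler_normB _ _))// mulrDl lerD.
Qed.

Lemma holder_boundZ (g a e : R) (A : X -> R) : holder_bound g A a ->
  holder_bound g (fun x => e * A x) (`|e| * a).
Proof. by move=> hA x y; rewrite -mulrBr normrM -mulrA ler_wpM2l. Qed.

Lemma holder_bound_le (g a b : R) (A : X -> R) :
  a <= b -> holder_bound g A a -> holder_bound g A b.
Proof.
by move=> ab hA x y; rewrite (le_trans (hA x y))// ler_wpM2r// powR_ge0.
Qed.

Lemma holder_bound_cst (g b : R) : holder_bound g (fun _ : X => b) 0.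
Proof. by move=> x y; rewrite subrr normr0 mul0r. Qed.

Lemma sup_le_ubound (S : set R) (c : R) : 0 <= c -> ubound S c -> sup S <= c.
Proof.
move=> c0 Sc; have [->|/set0P S0] := eqVneq S set0; first by rewrite sup0.
exact: ge_sup.
Qed.

Lemma holder_norm_le g A c b : 0 <= c -> holder_bound g A c ->
  (forall x, `|A x| <= b) -> holder_norm g A <= c + b.
Proof.
move=> c0 hA Ab; apply: lerD; apply: sup_le_ubound => //.
- by move=> _ [x [y [d0 d1 ->]]]; rewrite ler_pdivrMr ?powR_gt0.
- exact: le_trans (Ab point).
- by move=> _ [x _ <-].
Qed.

Lemma holder_norm_ge g A : 0 < g -> is_holder g A ->
  holder_bound g A (holder_norm g A) /\ forall x, `|A x| <= holder_norm g A.
Proof.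
move=> g0 [hA bA].
have H0 : 0 <= Hold g A.
  have [S0|/set0P[r Sr]] := eqVneq (holder_quotients g A) set0.
    by rewrite /Hold S0 sup0.
  apply: le_trans (ub_le_sup hA Sr).
  by case: Sr => x [y [_ _ ->]]; rewrite divr_ge0 ?powR_ge0.
have n0 x : `|A x| <= norm0 A by apply: ub_le_sup => //; exists x.
split=> [x y|x]; last by rewrite (le_trans (n0 x))// lerDr.
have [->|xy] := eqVneq x y.
  rewrite subrr normr0 mulr_ge0 ?powR_ge0// addr_ge0//.
  exact: le_trans (n0 point).
rewrite -ler_pdivrMr ?powR_gt0 ?mdist_gt0//.
rewrite (@le_trans _ _ (Hold g A))//; last first.
  by rewrite lerDl (le_trans _ (n0 point)).
apply: ub_le_sup => //; exists x, y; split=> //.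
  by rewrite mdist_gt0.
exact: mdist_le1.
Qed.

Lemma powR_lamV b n : (lam ^- n) `^ b = ((lam `^ b) ^+ n)^-1.
Proof. by rewrite -powR_invn ?(ltW lam0)// powRAC powR_invn ?powR_ge0. Qed.

(** Points that agree on [n] letters are the only ones for which something has to
    be checked: the others are at distance more than [lam ^- n], and there the
    bound [2 b] on the variation of [A] suffices. *)
Lemma holder_bound_agree g A n c b : 0 < g -> 0 <= c -> (forall x, `|A x| <= b) ->
  (forall x y, agree n x y -> `|A x - A y| <= c * mdist x y `^ g) ->
  holder_bound g A (c + 2 * b * (lam `^ g) ^+ n).
Proof.
move=> g0 c0 Ab hA x y.
have b0 : 0 <= b := le_trans (normr_ge0 _) (Ab point).
have [/mdist_leP/hA xy|xy] := leP (mdist x y) (lam ^- n).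
  rewrite (le_trans xy)// ler_wpM2r ?powR_ge0// lerDl.
  by rewrite !mulr_ge0// exprn_ge0// powR_ge0.
rewrite (@le_trans _ _ (2 * b))//.
  by rewrite (le_trans (ler_normB _ _))// mulr_natl mulr2n lerD.
rewrite (@le_trans _ _ (2 * b * (lam `^ g) ^+ n * mdist x y `^ g))//; last first.
  by rewrite ler_wpM2r ?powR_ge0// lerDr.
rewrite -mulrA ler_peMr ?mulr_ge0//.
have -> : (lam `^ g) ^+ n = ((lam ^- n) `^ g)^-1.
  by rewrite powR_lamV invrK.
rewrite mulrC ler_pdivlMr ?powR_gt0 ?invr_gt0 ?exprn_gt0// mul1r.
rewrite ge0_ler_powR ?nnegrE ?mdist_ge0 ?invr_ge0 ?exprn_ge0// ltW//.
Qed.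

(** The function [f] takes the value of [A] at a point chosen in each cylinder, so
    that the uniform distance is of order [(lam `^ g) ^- N]. On a cylinder the
    [g]-Hölder bound of [A], at scales below [lam ^- N], is an [a]-Hölder bound
    with the small constant [q ^+ N], where [q = lam `^ (a - g)]. *)
Lemma holder_approx_locally_constant (a g : R) A (e : R) :
  0 < a -> a < g -> 0 < e -> is_holder g A ->
  exists (N : nat) (f : X -> R), [/\ forall x y, agree N.+1 x y -> f x = f y,
    holder_bound a (fun x => A x - f x) e & forall x, `|A x - f x| <= e].
Proof.
move=> a0 ag e0 hA; have g0 := lt_trans a0 ag.
have [c c0 {}hA] := is_holder_bound g0 hA.
pose q := (lam `^ (g - a))^-1.
have q1 : q < 1.
  rewrite invf_lt1 ?powR_gt0//.
  have := @gt0_ltr_powR _ (g - a) _ 1 lam; rewrite powR1 subr_gt0 => ->//.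
    by rewrite nnegrE.
  by rewrite nnegrE ltW.
have q0 : 0 < q by rewrite invr_gt0 powR_gt0.
have [N Ne] : exists N, 3 * c * q ^+ N.+1 <= e.
  have : geometric (3 * c) q n @[n --> \oo] --> 0.
    by apply: cvg_geometric; rewrite ger0_norm ?ltW.
  move=> /cvgrPdist_le/(_ _ e0)[N _ /(_ N.+1)].
  rewrite /= sub0r normrN => /(_ (leqnSn _)) h; exists N.
  exact: le_trans (ler_norm _) h.
pose f x := A (xget point [set y | agree N.+1 x y]).
have rep x : agree N.+1 x (xget point [set y | agree N.+1 x y]).
  by apply: (@xgetPex _ point [set y | agree N.+1 x y]); exists x.
have qE : q ^+ N.+1 = (lam `^ a) ^+ N.+1 * ((lam `^ g) ^+ N.+1)^-1.
  rewrite /q -!exprVn -exprMn; congr (_ ^+ _).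
  by rewrite -!powRN -powRD ?(gt_eqF lam0) ?implybT//; congr (_ `^ _); ring.
have lg1 b : 0 < b -> 1 <= lam `^ b.
  by move=> b0; rewrite -(powRr0 lam) ler_powR// ltW.
have Af x : `|A x - f x| <= c * ((lam `^ g) ^+ N.+1)^-1.
  rewrite (le_trans (hA _ _))// ler_wpM2l// -powR_lamV.
  rewrite ge0_ler_powR ?nnegrE ?mdist_ge0 ?invr_ge0 ?exprn_ge0 ?(ltW lam0) ?(ltW g0)//.
  exact/mdist_leP.
exists N, f; split.
- move=> x y xy; rewrite /f; congr (A (xget _ _)); apply/seteqP; split=> z /=.
    exact/agree_trans/agree_sym.
  exact/agree_trans.
- have := @holder_bound_agree a (fun x => A x - f x) N.+1 (c * q ^+ N.+1) _ a0 _ Af.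
  move=> h x y; apply: le_trans (h _ _ x y) _.
  + by rewrite mulr_ge0// exprn_ge0// ltW.
  + move=> {}x {}y xy.
    have fE : f x = f y.
      rewrite /f; congr (A (xget _ _)); apply/seteqP; split=> z /=.
        exact/agree_trans/agree_sym.
      exact/agree_trans.
    rewrite fE (_ : _ - _ = A x - A y); last by ring.
    rewrite (le_trans (hA _ _))// -mulrA ler_wpM2l//.
    have -> : mdist x y `^ g = mdist x y `^ (g - a) * mdist x y `^ a.
      by rewrite -powRD subrK// (gt_eqF g0).
    rewrite ler_wpM2r ?powR_ge0// /q exprVn -powR_lamV.
    rewrite ge0_ler_powR ?nnegrE ?mdist_ge0 ?invr_ge0 ?exprn_ge0
      ?subr_ge0 ?(ltW lam0) ?(ltW ag)//.
    exact/mdist_leP.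
  + rewrite ler_wpM2r ?powR_ge0//; apply: le_trans Ne; rewrite qE; lra.
- move=> x; rewrite (le_trans (Af x))// (le_trans _ Ne)// qE.
  rewrite [leRHS](_ : _ =
    (3 * (lam `^ a) ^+ N.+1) * (c * ((lam `^ g) ^+ N.+1)^-1)); last by ring.
  rewrite ler_peMl// ?mulr_ge0 ?invr_ge0 ?exprn_ge0 ?powR_ge0//.
  by have := exprn_ege1 N.+1 (lg1 _ a0); lra.
Qed.

End sft_metric.

Section holder_space_metric.
Context (R : realType) (lam : R) (lam1 : 1 < lam).
Context (k : nat) (M : 'M[bool]_k) (ne : admissible M !=set0) (alpha : R).
Hypothesis alpha0 : 0 < alpha.
Notation X := (sft lam1 ne).
Notation H := (holder_space lam1 ne alpha).

Lemma holder_space_holder_bound (A : H) : exists c, holder_bound alpha A c.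
Proof. by have [c _ hc] := is_holder_bound alpha0 (svalP A); exists c. Qed.

Lemma holder_space_bounded_mfun (A : H) : bounded_mfun A.
Proof. by have [c hc] := holder_space_holder_bound A; exact: holder_bound_bmf hc. Qed.

Lemma holder_space_mdist (A B : H) :
  holder_bound alpha (fun x => A x - B x) (mdist A B) /\
  forall x, `|A x - B x| <= mdist A B.
Proof.
have [a ha] := holder_space_holder_bound A; have [b hb] := holder_space_holder_bound B.
have [_ [c bc]] := bounded_mfunD (holder_space_bounded_mfun A)
  (bounded_mfunZ (-1) (holder_space_bounded_mfun B)).
apply: holder_norm_ge => //; apply: (holder_bound_is_holder (holder_boundB ha hb) (b := c)).
by move=> x; have := bc x; rewrite mulN1r.
Qed.

Lemma mdist_holder_le (A B : H) (a b : R) : 0 <= a ->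
  holder_bound alpha (fun x => A x - B x) a -> (forall x, `|A x - B x| <= b) ->
  mdist A B <= a + b.
Proof. exact: holder_norm_le. Qed.

End holder_space_metric.


(** * Cycles of words and periodic orbits *)

Lemma sum_const_seq (R : realType) (T : Type) (s : seq T) (b : R) :
  \sum_(i <- s) b = b * (size s)%:R.
Proof. by rewrite big_const_seq count_predT iter_addr_0 mulr_natr. Qed.

Section cycle_sums.
Context (R : realType) (V : eqType) (c : seq V).
Hypothesis c_uniq : uniq c.
Implicit Types (F : V -> R).
Notation nx := (next c).

Lemma mem_iter_next n w : w \in c -> iter n nx w \in c.
Proof. by move=> wc; elim: n => //= n; rewrite mem_next. Qed.

Lemma sum_next F : \sum_(w <- c) F (nx w) = \sum_(w <- c) F w.
Proof.
rewrite -(big_map nx predT); apply: perm_big; apply: uniq_perm => //.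
  by rewrite map_inj_uniq//; exact: can_inj (prev_next c_uniq).
move=> w; apply/mapP/idP => [[v vc ->]|wc]; first by rewrite mem_next.
by exists (prev c w); rewrite ?mem_prev// next_prev.
Qed.

(** One full turn along the cycle [c], from any starting point. *)
Lemma sum_iter_next F w : w \in c ->
  \sum_(i < size c) F (iter i nx w) = \sum_(v <- c) F v.
Proof.
move=> wc; have [i s ciE] := rot_to wc.
have : fcycle nx (w :: s).
  by rewrite -ciE rot_cycle; exact: cycle_next.
rewrite /= => /fpathP[n sE].
have -> : size c = size (w :: s) by rewrite -ciE size_rot.
transitivity (\sum_(v <- w :: s) F v); last first.
  by apply: perm_big; rewrite -ciE perm_rot.
have ssE : rcons s w = traject nx (nx w) (size s).+1.
  by rewrite sE; congr traject; rewrite -(size_traject nx (nx w) n) -sE size_rcons.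
have wsE : w :: s = traject nx w (size s).+1.
  have : belast w (rcons s w) = belast w (traject nx (nx w) (size s).+1).
    by rewrite ssE.
  by rewrite belast_rcons => ->; rewrite trajectSr belast_rcons.
rewrite (big_nth w) big_mkord; apply: eq_bigr => -[j js] _.
by rewrite -(nth_traject nx js) -wsE.
Qed.

(** Full turns contribute nothing, so only fewer than [size c] terms matter. *)
Lemma cycle_sum_bound F b w n : w \in c -> \sum_(v <- c) F v = 0 ->
    {in c, forall v, `|F v| <= b} ->
  `|\sum_(i < n) F (iter i nx w)| <= b *+ size c.
Proof.
move=> wc F0 Fb; have b0 : 0 <= b := le_trans (normr_ge0 _) (Fb w wc).
have [m nm] := ubnP n; elim: m n nm w wc => // m IH n nm w wc.
have [nc|cn] := ltnP n (size c).
  rewrite (le_trans (ler_norm_sum _ _ _))// (@le_trans _ _ (b *+ n))//.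
    rewrite -[leRHS](_ : \sum_(i < n) b = _); last by rewrite sumr_const card_ord.
    by apply: ler_sum => i _; apply: Fb; exact: mem_iter_next.
  by apply: ler_wpMn2l => //; exact: ltnW.
rewrite -(subnKC cn) big_split_ord/= sum_iter_next// F0 add0r.
under eq_bigr do rewrite addnC iterD.
have c_gt0 : (0 < size c)%N by case: (c) wc.
apply: IH; last exact: mem_iter_next.
by rewrite -ltnS (leq_trans _ nm)// ltnS ltn_subrL c_gt0 (leq_trans c_gt0 cn).
Qed.

End cycle_sums.

Lemma birkhoff_split (R : realType) (T : Type) (f : T -> T) (G : T -> R) m n x :
  \sum_(i < m + n.+1) G (iter i f x) = \sum_(i < m) G (iter i f x) +
    (G (iter m f x) + \sum_(i < n) G (iter i f (iter m.+1 f x))).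
Proof.
rewrite big_split_ord big_ord_recl/= addn0; congr (_ + (_ + _)).
by apply: eq_bigr => i _; rewrite -iterS -iterD /bump leq0n add1n !addnS addnC.
Qed.

Section words.
Context (R : realType) (lam : R) (lam1 : 1 < lam).
Context (k : nat) (M : 'M[bool]_k) (ne : admissible M !=set0) (N : nat).
Notation X := (sft lam1 ne).
Notation V := {ffun 'I_N.+1 -> 'I_k}.
Implicit Types (x y : X) (w v : V).

Definition word x : V := [ffun i : 'I_N.+1 => sval x i].

Lemma eq_word x y : word x = word y <-> agree N.+1 x y.
Proof.
split=> [/ffunP xy i iN|xy]; first by have := xy (Ordinal iN); rewrite !ffunE.
by apply/ffunP => i; rewrite !ffunE; exact: xy.
Qed.

(** Consecutive words overlap: [v] is [w] deprived of its first letter and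
    extended by one letter. *)
Definition word_edge : rel V := fun w v =>
  M (w ord0) (v ord0) &&
  [forall i : 'I_N.+1, forall j : 'I_N.+1, (j == i.+1 :> nat) ==> (w j == v i)].

Lemma word_edgeP x : word_edge (word x) (word (shift x)).
Proof.
apply/andP; split; first by rewrite !ffunE; exact: (svalP x).
apply/forallP => i; apply/forallP => j; apply/implyP => /eqP ji.
by rewrite !ffunE ji.
Qed.

Lemma sval_iter_shift n x i : sval (iter n shift x) i = sval x (n + i)%N.
Proof. by elim: n i => // n IH i; rewrite /= IH addnS. Qed.

Definition itinerary n x : seq V := [seq word (iter i shift x) | i <- iota 0 n].

Lemma sorted_itinerary n x : sorted word_edge (itinerary n x).
Proof.
rewrite /itinerary sorted_map; case: n => //= n.
have : forall m, path (relpre (fun i => word (iter i shift x)) word_edge)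
    m (iota m.+1 n).
  by elim: n => //= n IH m; rewrite IH andbT; exact: word_edgeP.
exact.
Qed.

Section orbit.
Variables (c : seq V) (c_uniq : uniq c) (c_cycle : cycle word_edge c).
Notation nx := (next c).

(** The periodic point that reads the first letters of the words met along the
    cycle [c], starting from [w]; it is meaningful when [w] is in [c]. *)
Definition orbit_point w : X :=
  xget point [set x : X | forall i, sval x i = (iter i nx w) ord0].

Lemma sval_orbit_point w i : w \in c ->
  sval (orbit_point w) i = (iter i nx w) ord0.
Proof.
move=> wc; have adm : admissible M (fun i => (iter i nx w) ord0).
  move=> n; have := next_cycle c_cycle (mem_iter_next n wc).
  by case/andP.
have : [set x : X | forall i, sval x i = (iter i nx w) ord0] (orbit_point w).
  by apply: xgetPex; exists (exist _ _ adm).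
exact.
Qed.

(** By the overlap of consecutive words, the letter of index [i] of [w] is the
    first letter of the [i]-th successor of [w] in the cycle. *)
Lemma word_orbit_point w : w \in c -> word (orbit_point w) = w.
Proof.
move=> wc; apply/ffunP => i; rewrite ffunE sval_orbit_point//.
case: i => i; elim: i w wc => [|i IH] w wc iN /=.
  by congr (w _); exact/val_inj.
have := IH (nx w) _ (ltnW iN); rewrite mem_next -iterSr/= => -> //.
have /andP[_ /forallP/(_ (Ordinal (ltnW iN)))/forallP/(_ (Ordinal iN))] :=
  next_cycle c_cycle wc.
by rewrite eqxx => /eqP.
Qed.

Lemma shift_orbit_point w : w \in c ->
  shift (orbit_point w) = orbit_point (nx w).
Proof.
move=> wc; apply: sft_eqP => -[i /eqP]; apply; rewrite /= !sval_orbit_point//.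
  by rewrite -iterSr.
by rewrite mem_next.
Qed.

Lemma iter_shift_orbit_point n w : w \in c ->
  iter n shift (orbit_point w) = orbit_point (iter n nx w).
Proof.
by move=> wc; elim: n => //= n ->; rewrite shift_orbit_point// mem_iter_next.
Qed.

(** The condition bears on the edge and not only on the word of [x]: the graph may
    have edges between vertices of [c] that are not edges of [c], and an orbit
    that used one of them would leave the periodic orbit unnoticed. *)
Definition follows x := (word x \in c) && (word (shift x) == nx (word x)).

Lemma follows_orbit_point w : w \in c -> follows (orbit_point w).
Proof.
move=> wc; rewrite /follows shift_orbit_point// !word_orbit_point ?mem_next//.
by rewrite wc eqxx.
Qed.

Lemma follows_agree x y : agree N.+2 x y -> follows x = follows y.
Proof.
move=> xy; rewrite /follows.
have -> : word x = word y by apply/eq_word => i iN; apply: xy; exact: ltnW.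
suff -> : word (shift x) = word (shift y) by [].
by apply/eq_word => i iN; exact: xy.
Qed.

Lemma word_iter_follows n x :
  (forall i, (i < n)%N -> follows (iter i shift x)) ->
  word (iter n shift x) = iter n nx (word x).
Proof.
elim: n => // n IH fx; rewrite /= -IH => [|i /ltnW]; last exact: fx.
by have /andP[_ /eqP] := fx n (leqnn _).
Qed.

Lemma agree_follows n x : (forall i, (i < n)%N -> follows (iter i shift x)) ->
  agree n x (orbit_point (word x)).
Proof.
move=> fx i iN; have wx : word x \in c.
  by have /andP[] := fx 0%N (leq_ltn_trans (leq0n i) iN).
rewrite sval_orbit_point// -word_iter_follows; last first.
  by move=> j ji; apply: fx; exact: ltn_trans iN.
by rewrite ffunE sval_iter_shift addn0.
Qed.

(** Following [c] forever determines all the letters. *)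
Lemma follows_forever x : (forall i, follows (iter i shift x)) ->
  x = orbit_point (word x).
Proof.
move=> fx; apply: sft_eqP => -[i /eqP]; apply.
by apply: (@agree_follows i.+1).
Qed.

Definition stray x : R := (~~ follows x)%:R.

Definition orbit_mean (F : X -> R) : R :=
  (\sum_(w <- c) F (orbit_point w)) / (size c)%:R.

Lemma sum_geometric (r : R) n : \sum_(i < n) r ^+ (n - i) * (1 - r) = r - r ^+ n.+1.
Proof.
elim: n => [|n IH]; first by rewrite big_ord0 expr1 subrr.
rewrite big_ord_recl/= subn0; under eq_bigr do rewrite subSS.
rewrite IH !exprS; ring.
Qed.

Section shadowing.
Variables (alpha e : R) (F : X -> R).
Hypotheses (alpha0 : 0 < alpha) (F_holder : holder_bound alpha F e)
  (F_le : forall x, `|F x| <= e).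

Let r := (lam `^ alpha)^-1.

Let e0 : 0 <= e. Proof. exact: le_trans (normr_ge0 _) (F_le point). Qed.

Let r01 : 0 < r < 1.
Proof.
rewrite invr_gt0 powR_gt0 ?(lt_trans _ lam1)//= invf_lt1 ?powR_gt0 ?(lt_trans _ lam1)//.
have := @gt0_ltr_powR _ alpha alpha0 1 lam; rewrite powR1 => ->//.
  by rewrite nnegrE.
by rewrite nnegrE ltW// (lt_trans _ lam1).
Qed.

(** At time [i] of a segment of length [n] that follows [c], the orbit agrees with
    the periodic one on the [n - i] remaining letters; the differences of the
    values of [F] are dominated by a geometric series of ratio [r]. *)
Lemma shadowing_sum n x : (forall i, (i < n)%N -> follows (iter i shift x)) ->
  \sum_(i < n) F (iter i shift x) <=
  \sum_(i < n) F (iter i shift (orbit_point (word x))) + e / (1 - r).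
Proof.
move=> fx; have /andP[r0 r1] := r01; rewrite -lerBlDl -sumrB.
apply: (@le_trans _ _ (\sum_(i < n) e * r ^+ (n - i))).
  apply: ler_sum => i _; apply: le_trans (ler_norm _) _.
  rewrite (le_trans (F_holder _ _))// ler_wpM2l// /r exprVn -powR_lamV//.
  have l0 := lt_trans ltr01 lam1.
  rewrite ge0_ler_powR ?nnegrE ?mdist_ge0 ?invr_ge0 ?exprn_ge0 ?(ltW l0) ?(ltW alpha0)//.
    apply/mdist_leP => j ji; rewrite !sval_iter_shift; apply: agree_follows fx _ _.
    by rewrite -ltn_subRL.
rewrite -mulr_sumr ler_wpM2l// -div1r ler_pdivlMr ?subr_gt0// mulr_suml.
by rewrite sum_geometric; have := exprn_ge0 n.+1 (ltW r0); lra.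
Qed.

(** Per unit of the norm [e] of the perturbation: the shadowing error, then the
    incomplete turn of the periodic orbit (at most [size c] terms, each at most
    twice the norm), and finally [2] for the stray point that ends a segment. *)
Definition excess_const : R := 1 / (1 - r) + 2 *+ size c + 2.

Let mean_le : c != [::] -> `|orbit_mean F| <= e.
Proof.
move=> c0; have sc : (0 : R) < (size c)%:R by rewrite ltr0n lt0n size_eq0.
rewrite normrM normfV (gtr0_norm sc) ler_pdivrMr//.
rewrite (le_trans (ler_norm_sum _ _ _))// -sum_const_seq.
by apply: ler_sum => w _; exact: F_le.
Qed.

Lemma birkhoff_follows n x : c != [::] ->
  (forall i, (i < n)%N -> follows (iter i shift x)) ->
  \sum_(i < n) F (iter i shift x) <=
    n%:R * orbit_mean F + e * (excess_const - 2).
Proof.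
move=> c0; have sc : (0 : R) < (size c)%:R by rewrite ltr0n lt0n size_eq0.
have /andP[r0 r1] := r01.
have i0 : 0 <= 1 / (1 - r) by rewrite divr_ge0 ?subr_ge0 ?ltW.
case: n => [|n] fx.
  rewrite big_ord0 mul0r add0r mulr_ge0// /excess_const addrK addr_ge0//.
have wx : word x \in c by have /andP[] := fx 0%N isT.
rewrite (le_trans (shadowing_sum fx))//.
have := @cycle_sum_bound R _ c c_uniq (fun w => F (orbit_point w) - orbit_mean F)
  (2 * e) (word x) n.+1 wx.
have -> : \sum_(v <- c) (F (orbit_point v) - orbit_mean F) = 0.
  rewrite sumrB sum_const_seq /orbit_mean.
  by rewrite divfK ?subrr// gt_eqF.
move=> /(_ erefl) h.
have {}h : `|\sum_(i < n.+1) (F (orbit_point (iter i nx (word x))) - orbit_mean F)|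
    <= 2 * e *+ size c.
  apply: h => v _; rewrite (le_trans (ler_normB _ _))// mulr_natl mulr2n.
  by apply: lerD; [exact: F_le|exact: mean_le].
have := le_trans (ler_norm _) h; rewrite sumrB sumr_const card_ord.
under [X in _ -> X + _ <= _]eq_bigr do rewrite iter_shift_orbit_point//.
rewrite /excess_const addrK -(mulr_natr (orbit_mean F)) -(mulr_natr (2 * e)).
rewrite -(mulr_natr 2) => h1; lra.
Qed.

(** The orbit segment is cut at its stray points. Each piece between two of them
    is controlled by [birkhoff_follows]; the [1] added to the number of stray
    points accounts for the last piece, which none of them ends. *)
Lemma birkhoff_le n x : c != [::] ->
  \sum_(i < n) F (iter i shift x) <= n%:R * orbit_mean F +
    e * excess_const * (1 + \sum_(i < n) stray (iter i shift x)).
Proof.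
move=> c0; have /andP[r0 r1] := r01.
have i0 : 0 <= 1 / (1 - r) by rewrite divr_ge0 ?subr_ge0 ?ltW.
have ec2 : 0 <= excess_const - 2.
  by rewrite /excess_const addrK addr_ge0// mulrn_wge0.
have s0 m y : 0 <= \sum_(i < m) stray (iter i shift y).
  by apply: sumr_ge0 => i _; rewrite ler0n.
have [m nm] := ubnP n; elim: m n nm x => // m IH n nm x.
have [fx|] := pselect (forall i, (i < n)%N -> follows (iter i shift x)).
  rewrite (le_trans (birkhoff_follows c0 fx))// lerD2l -mulrA ler_wpM2l//.
  have := s0 n x; nra.
move=> /existsNP[j0 /not_implyP[j0n /negP nfj0]].
have ex : exists j, (j < n)%N && ~~ follows (iter j shift x).
  by exists j0; rewrite j0n.
(* [j] is the time of the first stray point *)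
case: (ex_minnP ex) => j /andP[jn nfj] jmin.
have fj i : (i < j)%N -> follows (iter i shift x).
  move=> ij; apply: contraT => nfi.
  by have := jmin i; rewrite nfi (ltn_trans ij jn) => /(_ isT); rewrite leqNgt ij.
have nE : n = (j + (n - j.+1).+1)%N by rewrite -subSn// subSS subnKC// ltnW.
have := IH (n - j.+1)%N _ (iter j.+1 shift x).
have := birkhoff_follows c0 fj; have := le_trans (ler_norm _) (F_le (iter j shift x)).
have := mean_le c0; rewrite ler_norml => /andP[mean_ge _].
have := s0 j x.
have sj : stray (iter j shift x) = 1 by rewrite /stray nfj.
set T := (n - j.+1)%N in nE *; rewrite nE !birkhoff_split sj.
rewrite natrD -[in (_ + T.+1%:R)]natr1.
set S1 := \sum_(i < j) _; set S2 := \sum_(i < T) _.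
set S3 := \sum_(i < j) _; set S4 := \sum_(i < T) _.
move=> h1 h2 h3 /(_ _)h4.
have {}h4 : S2 <= T%:R * orbit_mean F + e * excess_const * (1 + S4).
  apply: h4; rewrite -ltnS (leq_trans _ nm)// ltnS.
  by rewrite /T ltn_subrL (leq_ltn_trans (leq0n j) jn).
have h5 : 0 <= e * excess_const * S1.
  by rewrite !mulr_ge0 ?e0//; lra.
lra.
Qed.

End shadowing.
End orbit.
End words.

(** * Locking of the periodic orbit *)

(** The integral of a Birkhoff sum of length [n] is [n] times the integral, and
    the constant [K] disappears after division by [n]. *)
Lemma invariant_integral_le d (T : measurableType d) (R : realType) (f : T -> T)
    (mf : measurable_fun setT f) (nu : probability T R) (G : T -> R) (a K : R) :
  (forall B, measurable B -> nu (f @^-1` B) = nu B) -> bounded_mfun G ->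
  (forall n x, \sum_(i < n) G (iter i f x) <= n%:R * a + K) ->
  \int[nu]_x G x <= a.
Proof.
move=> inv bG GS; rewrite leNgt; apply/negP => aG.
pose t := \int[nu]_x G x - a; have t0 : 0 < t by rewrite subr_gt0.
pose n := Num.Def.archi_bound `|K / t|.
have : n%:R * \int[nu]_x G x <= n%:R * a + K.
  rewrite -(invariant_integral_birkhoff mf inv)//.
  rewrite -[leRHS](bounded_mfun_integral_cst nu); apply: bounded_mfun_le_integral => //.
    by apply: (bounded_mfun_sum n (fun i => bounded_mfun_iter mf i bG)).
  exact: bounded_mfun_cst.
rewrite -lerBlDl -mulrBr -/t -ler_pdivlMr// leNgt => /negP; apply.
exact: le_lt_trans (ler_norm _) (archi_boundP (normr_ge0 _)).
Qed.

Section locking.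
Context (R : realType) (lam : R) (lam1 : 1 < lam).
Context (k : nat) (M : 'M[bool]_k) (ne : admissible M !=set0) (N : nat).
Notation X := (sft lam1 ne).
Notation V := {ffun 'I_N.+1 -> 'I_k}.
Variables (c : seq V) (c0 : c != [::]) (c_uniq : uniq c).
Variable c_cycle : cycle (@word_edge k M N) c.
Notation nx := (next c).
Notation pt := (@orbit_point R lam lam1 k M ne N c).
Notation wd := (@word R lam lam1 k M ne N).
Notation str := (@stray R lam lam1 k M ne N c).
Notation mean := (@orbit_mean R lam lam1 k M ne N c).
Notation fol := (@follows R lam lam1 k M ne N c).

Let orbit_n0 : map pt c != [::].
Proof. by rewrite -size_eq0 size_map size_eq0. Qed.

Definition orbit_measure : probability X R :=
  equidistribution_prob R point orbit_n0.

Lemma orbit_measureE B :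
  orbit_measure B = ((\sum_(w <- c) \1_B (pt w)) / (size c)%:R)%:E.
Proof. by rewrite [LHS]equidistributionE big_map size_map. Qed.

Lemma integral_orbit_measure (F : X -> R) : bounded_mfun F ->
  \int[orbit_measure]_x F x = mean F.
Proof.
move=> bF; rewrite (integral_equidistribution _ _ bF).
by rewrite big_map size_map.
Qed.

Lemma orbit_measure_invariant : shift_invariant orbit_measure.
Proof.
move=> B mB; rewrite !orbit_measureE; congr ((_ / _)%:E).
rewrite -[RHS](sum_next c_uniq) big_seq [RHS]big_seq; apply: eq_bigr => w wc.
by rewrite -shift_orbit_point.
Qed.

Let stray_le1 x : `|str x| <= 1.
Proof. by rewrite ger0_norm ?ler0n// lern1 leq_b1. Qed.

Lemma holder_bound_stray g : 0 < g -> holder_bound g str (2 * (lam `^ g) ^+ N.+2).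
Proof.
move=> g0; have := @holder_bound_agree _ _ lam1 _ _ ne g str N.+2 0 1 g0 (lexx _) stray_le1.
rewrite add0r mulr1; apply=> x y xy.
by rewrite /stray (follows_agree c xy) subrr normr0 mul0r.
Qed.

Lemma bounded_mfun_stray : bounded_mfun str.
Proof. exact: holder_bound_bmf ltr01 (holder_bound_stray ltr01). Qed.

Lemma measurable_stray : measurable [set x | ~~ fol x].
Proof.
apply/(measurable_indicP R).
rewrite (_ : \1_ _ = str); first by case: bounded_mfun_stray.
apply/funext => x; rewrite indicE /stray; congr (_%:R); congr nat_of_bool.
by apply/idP/idP => [/set_mem//|h]; exact/mem_set.
Qed.

Lemma integral_stray (nu : probability X R) :
  \int[nu]_x str x = fine (nu [set x | ~~ fol x]).
Proof.
rewrite -(integral_indic_prob nu measurable_stray); apply: eq_Rintegral => x _.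
rewrite indicE /stray; congr (_%:R); congr nat_of_bool.
by apply/idP/idP => [h|/set_mem//]; exact/mem_set.
Qed.

(** Almost every point never strays, hence lies on the periodic orbit, where the
    number of visits to [B] during one turn does not depend on the starting
    point. Integrating this number gives [nu B]. *)
Lemma invariant_stray0_unique (nu : probability X R) : shift_invariant nu ->
  \int[nu]_x str x <= 0 ->
  forall B, measurable B -> nu B = orbit_measure B.
Proof.
move=> inv s0 B mB; have mS := @measurable_shift R lam lam1 k M ne.
pose Z := [set x | ~~ fol x]; have mZ : measurable Z := measurable_stray.
have nuZ : nu Z = 0%E.
  apply/eqP; rewrite eq_le measure_ge0 andbT -[nu Z]fineK ?fin_num_measure//.
  by rewrite lee_fin -integral_stray.
have negZ i : nu.-negligible (iter i shift @^-1` Z).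
  suff [mi i0] : measurable (iter i shift @^-1` Z) /\ nu (iter i shift @^-1` Z) = 0%E.
    exact/negligibleP.
  elim: i => [//|i [mi i0]].
  rewrite (_ : iter i.+1 shift @^-1` Z = shift @^-1` (iter i shift @^-1` Z)); last first.
    by apply/seteqP; split => x /=; rewrite -iterSr.
  split; last by rewrite inv.
  by rewrite -[_ @^-1` _]setTI; exact: mS.
have b1 : bounded_mfun (\1_B : X -> R) by exact: bounded_mfun_indic.
have bS := bounded_mfun_sum (size c) (fun i => bounded_mfun_iter mS i b1).
pose s := \sum_(w <- c) (\1_B (pt w) : R).
have sc : (size c)%:R != 0 :> R by rewrite pnatr_eq0 size_eq0.
have : \int[nu]_x (\sum_(i < size c) \1_B (iter i shift x)) = \int[nu]_x (cst s x).
  rewrite /Rintegral; congr fine; apply: ae_eq_integral => //.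
    by apply/measurable_EFinP; case: bS.
  by apply/measurable_EFinP; have [ms _] := @bounded_mfun_cst _ X R s; exact: ms.
  apply: (negligibleS _ (negligible_bigcup negZ)) => x /= h; apply: contrapT => nx_.
  apply: h => _; congr EFin.
  have fx i : fol (iter i shift x) by apply: contrapT => /negP nf; apply: nx_; exists i.
  have wx : wd x \in c by have /andP[] := fx 0%N.
  rewrite (follows_forever c_cycle fx) /s -(sum_iter_next c_uniq _ wx).
  by apply: eq_bigr => i _; rewrite iter_shift_orbit_point.
rewrite (invariant_integral_birkhoff mS inv)// bounded_mfun_integral_cst.
rewrite (integral_indic_prob nu mB) => nuB.
rewrite -[LHS]fineK ?fin_num_measure// orbit_measureE; congr EFin.
by rewrite -/s -nuB mulrC mulKf.
Qed.

(** A potential [A] close, in alpha-Hölder norm, to the weight [g] of words with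
    the penalty [eps] at stray points and a constant [C]; the cycle [c] has
    maximal mean weight. *)
Section potential.
Variables (g : V -> R) (m K : R).
Hypotheses (g_mean : \sum_(v <- c) g v = m *+ size c)
  (g_le : forall s, sorted (@word_edge k M N) s -> \sum_(v <- s) g v <= m *+ size s + K).
Variables (alpha eps C e : R) (A : X -> R).
Hypotheses (alpha0 : 0 < alpha) (eps0 : 0 < eps).
Let B x := g (wd x) - eps * str x + C.
Hypotheses (bA : bounded_mfun A) (AB_holder : holder_bound alpha (fun x => A x - B x) e)
  (AB_le : forall x, `|A x - B x| <= e)
  (e_small : e * excess_const lam c alpha <= eps / 2).

Let F x := A x - B x.

Let mean_A : mean A = m + C + mean F.
Proof.
have sc : (size c)%:R != 0 :> R by rewrite pnatr_eq0 size_eq0.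
apply: (mulIf sc); rewrite /orbit_mean mulrDl !divfK//.
transitivity (\sum_(w <- c) (g w + C + F (pt w))); last first.
  by rewrite !big_split/= g_mean sum_const_seq -(mulr_natr m) mulrDl.
rewrite big_seq [RHS]big_seq; apply: eq_bigr => w wc.
have -> : g w = g (wd (pt w)) by rewrite word_orbit_point.
have : str (pt w) = 0 by rewrite /stray follows_orbit_point.
by rewrite /F /B => ->; ring.
Qed.

(** Half of the penalty pays for what the perturbation [A - B] can gain at stray
    points, by [birkhoff_le] and the smallness of [e]; the other half remains. *)
Lemma locking_integral_le (nu : probability X R) : shift_invariant nu ->
  \int[nu]_x A x + eps / 2 * \int[nu]_x str x <= \int[orbit_measure]_x A x.
Proof.
move=> inv; rewrite integral_orbit_measure//.
have bs := bounded_mfun_stray; have bs2 := bounded_mfunZ (eps / 2) bs.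
rewrite -bounded_mfun_integralZ// -bounded_mfun_integralD//.
apply: (@invariant_integral_le _ X R shift (@measurable_shift R lam lam1 k M ne)
  nu _ _ (K + eps / 2) inv); first exact: bounded_mfunD.
move=> n x.
have := birkhoff_le c_uniq c_cycle alpha0 AB_holder AB_le n x c0.
have := g_le (sorted_itinerary N n x).
rewrite /itinerary big_map size_map size_iota -[n in iota 0 n]subn0 -/(index_iota 0 n).
rewrite big_mkord.
have S0 : 0 <= \sum_(i < n) str (iter i shift x).
  by apply: sumr_ge0 => i _; rewrite ler0n.
set S := \sum_(i < n) _ in S0 *; set G := \sum_(i < n) _.
rewrite -/F => h1 h2.
have -> : \sum_(i < n) (A (iter i shift x) + eps / 2 * str (iter i shift x)) =
   G + (- eps / 2) * S + n%:R * C + \sum_(i < n) F (iter i shift x).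
  have -> : n%:R * C = \sum_(i < n) C by rewrite sumr_const card_ord mulr_natl.
  rewrite /G /S mulr_sumr -!big_split/=; apply: eq_bigr => i _.
  by rewrite /F /B; field.
rewrite mean_A; move: h1; rewrite -mulr_natl => h1.
have h3 : e * excess_const lam c alpha * (1 + S) <= eps / 2 * (1 + S).
  by rewrite ler_wpM2r// addr_ge0.
move: h2; rewrite /F; set P := \sum_(i < n) _; set Q := mean _ => h2; nra.
Qed.

Lemma locking_maximizing : maximizing A orbit_measure.
Proof.
split; first exact: orbit_measure_invariant.
move=> nu /locking_integral_le; apply: le_trans; rewrite lerDl mulr_ge0//.
  by rewrite divr_ge0// ltW.
by rewrite integral_stray fine_ge0.
Qed.

Lemma locking_unique nu : maximizing A nu ->
  forall D, measurable D -> nu D = orbit_measure D.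
Proof.
move=> [inv numax]; apply: invariant_stray0_unique => //.
have := numax _ orbit_measure_invariant; have := locking_integral_le inv.
move=> h1 h2; have : eps / 2 * \int[nu]_x str x <= 0 by lra.
by rewrite pmulr_rle0// divr_gt0.
Qed.

End potential.
End locking.


(** * Pressure *)

Section pressure.
Context (R : realType) (lam : R) (lam1 : 1 < lam).
Context (k : nat) (M : 'M[bool]_k) (ne : admissible M !=set0).
Notation X := (sft lam1 ne).

Lemma pressure_le (A B : X -> R) s : bounded_mfun A -> bounded_mfun B ->
  (forall x, A x <= B x + s) -> (pressure A <= pressure B + s%:E)%E.
Proof.
move=> bA bB AB; apply: ge_ereal_sup => _ [nu inv <-].
apply: (@le_trans _ _ (entropy nu + (\int[nu]_x B x)%:E + s%:E)%E); last first.
  by rewrite leeD2r//; apply: ereal_sup_ubound; exists nu.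
rewrite -addeA leeD2l// -EFinD lee_fin -[X in _ + X](bounded_mfun_integral_cst nu).
have bs := @bounded_mfun_cst _ X R s; rewrite -bounded_mfun_integralD//.
by apply: bounded_mfun_le_integral => //; exact: bounded_mfunD.
Qed.

(** By [pressure_le] in both directions, the pressure of [B] is a real number [p]
    with [|p| <= s]. *)
Lemma pressure_normalization (A B : X -> R) s : bounded_mfun A -> bounded_mfun B ->
  (forall x, `|A x - B x| <= s) -> pressure A = 0%E ->
  exists2 p, `|p| <= s & pressure (fun x => B x - p) = 0%E.
Proof.
move=> bA bB AB A0.
have AB1 x : A x <= B x + s by have := AB x; rewrite ler_norml; lra.
have BA1 x : B x <= A x + s by have := AB x; rewrite ler_norml; lra.
have := pressure_le bA bB AB1; have := pressure_le bB bA BA1; rewrite A0 add0e.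
case pB : (pressure B) => [p| |]//; rewrite -EFinD !lee_fin => h1 h2.
have bBp : bounded_mfun (fun x => B x - p)
  by apply: (bounded_mfunD bB); exact: (@bounded_mfun_cst _ X R (- p)).
exists p; first by rewrite ler_norml; lra.
apply/eqP; rewrite eq_le; apply/andP; split.
  have := @pressure_le (fun x => B x - p) B (- p) bBp bB (fun=> lexx _).
  by rewrite pB -EFinD subrr.
have : (pressure B <= pressure (fun x => B x - p)%R + p%:E)%E.
  by apply: pressure_le => // x; rewrite subrK.
rewrite pB; case: (pressure _) => [r| |]; rewrite ?leey ?addNye ?leeNy_eq//.
by rewrite -EFinD !lee_fin lerDr.
Qed.

End pressure.

(** * Density of the locked potentials *)

Section strong_convergence.
Context (R : realType) (lam : R) (lam1 : 1 < lam).
Context (k : nat) (M : 'M[bool]_k) (ne : admissible M !=set0).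
Notation X := (sft lam1 ne).

Lemma hausdorff_dist_refl (K : set X) : hausdorff_dist K K = 0.
Proof.
have inf0 (x : X) (f : X -> R) : K x -> f x = 0 -> (forall y, 0 <= f y) ->
    inf [set f y | y in K] = 0.
  move=> Kx fx f0; apply/eqP; rewrite eq_le; apply/andP; split.
    by apply: ge_inf; [exists 0 => _ [y _ <-]|exists x].
  by apply: lb_le_inf; [exists (f x), x|move=> _ [y _ <-]].
have sup_zero (S : set R) : S `<=` [set 0] -> sup S = 0.
  by move=> /subset_set1[->|->]; rewrite ?sup0 ?sup1.
rewrite /hausdorff_dist !sup_zero ?maxxx//.
  move=> _ [y Ky <-] /=.
  by apply: (inf0 y) => [//||z]; [exact: mdistxx|exact: mdist_ge0].
move=> _ [x Kx <-] /=.
by apply: (inf0 x) => [//||z]; [exact: mdistxx|exact: mdist_ge0].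
Qed.

(** The support is determined by the measures of open sets. *)
Lemma eq_strongly_converges (mun : nat -> probability X R) (mu : probability X R) :
  (\forall n \near \oo, forall B, measurable B -> mun n B = mu B) ->
  strongly_converges mun mu.
Proof.
move=> eqmu; split.
  move=> f _; apply: cvg_near_cst; apply: filterS eqmu => n eqn.
  by rewrite /Rintegral; congr fine; apply: eq_measure_integral => B mB _; exact: eqn.
apply: cvg_near_cst; apply: filterS eqmu => n eqn.
rewrite (_ : supp (mun n) = supp mu) ?hausdorff_dist_refl//.
apply/seteqP; split=> x sx U oU Ux; have := sx U oU Ux.
  by rewrite eqn//; exact: open_measurable_sft.
by rewrite -eqn//; exact: open_measurable_sft.
Qed.

End strong_convergence.

Section existence.
Context (R : realType) (lam : R) (lam1 : 1 < lam).
Context (k : nat) (M : 'M[bool]_k) (ne : admissible M !=set0).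
Notation X := (sft lam1 ne).

(** A long enough path exists, namely the itinerary of any point, and it must
    repeat a word. *)
Lemma word_graph_cycle (N : nat) (g : {ffun 'I_N.+1 -> 'I_k} -> R) :
  exists (c : seq {ffun 'I_N.+1 -> 'I_k}) (m K : R),
    [/\ c != [::], uniq c, cycle (@word_edge k M N) c,
      \sum_(v <- c) g v = m *+ size c &
      forall s, sorted (@word_edge k M N) s -> \sum_(v <- s) g v <= m *+ size s + K].
Proof.
pose L := #|{: {ffun 'I_N.+1 -> 'I_k}}|.+1.
apply: (max_mean_cycle g (sorted_itinerary N L (point : X))).
apply/negP => /card_uniqP; rewrite size_map size_iota => cL.
by have := max_card (mem (itinerary N L (point : X))); rewrite cL ltnn.
Qed.

Lemma excess_const_gt0 (N : nat) (c : seq {ffun 'I_N.+1 -> 'I_k}) (alpha : R) :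
  0 < alpha -> 0 < excess_const lam c alpha.
Proof.
move=> alpha0; have l0 := lt_trans ltr01 lam1.
rewrite /excess_const ltr_pwDr// addr_ge0 ?mulrn_wge0//.
rewrite divr_ge0// subr_ge0 invf_le1 ?powR_gt0//.
by rewrite -(powRr0 lam) ler_powR// ltW.
Qed.

(** The function [B] is the locally constant approximation of [A], penalized off
    a cycle of maximal mean weight and normalized to zero pressure; being locally
    constant it is Hölder for every exponent. Any [d] for which the perturbation
    gains at most [eps / 2] per stray point is a radius of locking. *)
Lemma locked_approximation (alpha gamma r : R) (A : X -> R) :
  0 < alpha -> alpha < gamma -> 0 < r -> is_holder gamma A -> pressure A = 0%E ->
  exists (B : X -> R) (d : R) (mu : probability X R),
    [/\ is_holder alpha B /\ is_holder gamma B, pressure B = 0%E,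
       holder_bound alpha (fun x => A x - B x) r /\ (forall x, `|A x - B x| <= r),
       0 < d &
       forall A', bounded_mfun A' -> holder_bound alpha (fun x => A' x - B x) d ->
         (forall x, `|A' x - B x| <= d) ->
       maximizing A' mu /\ forall nu, maximizing A' nu ->
         forall D, measurable D -> nu D = mu D].
Proof.
move=> a0 ag r0 hA pA; have g0 := lt_trans a0 ag.
pose e := r / 4; have e0 : 0 < e by rewrite divr_gt0.
have er : e * 4 = r by rewrite /e divfK// gt_eqF.
have [N [f [f_agree Af_holder Af_le]]] :=
  holder_approx_locally_constant a0 ag e0 hA.
pose g (v : {ffun 'I_N.+1 -> 'I_k}) := f (xget point [set x : X | word N x = v]).
have gE x : g (word N x) = f x.
  apply: f_agree; apply/eq_word.
  by apply: (@xgetPex _ point [set y : X | word N y = word N x]); exists x.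
have [c [m [K [c0 c_uniq c_cycle g_mean g_le]]]] := word_graph_cycle g.
(* [L] is a Hölder constant of [stray]: the word length [N] is chosen before the
   penalty [eps], so [eps * L] can still be made small *)
pose L := 2 * (lam `^ alpha) ^+ N.+2.
have L0 : 0 <= L by rewrite mulr_ge0// exprn_ge0// powR_ge0.
pose eps := e / (L + 1).
have L10 : 0 < L + 1 by rewrite ltr_wpDl.
have eps0 : 0 < eps by rewrite divr_gt0.
have epsL : eps * L <= e.
  by rewrite /eps mulrAC ler_pdivrMr// ler_wpM2l ?(ltW e0)// lerDl.
have epse : eps <= e.
  by rewrite /eps ler_pdivrMr// ler_peMr ?(ltW e0)// lerDr.
have str_le x : `|stray (lam1 := lam1) (ne := ne) c x| <= 1.
  by rewrite ger0_norm ?ler0n// lern1 leq_b1.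
pose B0 x := f x - eps * stray c x.
have AB0E x : A x - B0 x = (A x - f x) - - eps * stray c x.
  by rewrite /B0; ring.
have AB0_le x : `|A x - B0 x| <= 2 * e.
  rewrite AB0E mulr_natl mulr2n (le_trans (ler_normB _ _))// lerD//.
  rewrite normrM normrN (gtr0_norm eps0) (le_trans _ epse)//.
  by rewrite -[leRHS]mulr1 ler_wpM2l// ltW.
have AB0_holder : holder_bound alpha (fun x => A x - B0 x) r.
  rewrite (funext AB0E).
  apply: holder_bound_le (holder_boundB Af_holder (holder_boundZ (- eps) (holder_bound_stray c a0))).
  by rewrite normrN (gtr0_norm eps0) -/L; lra.
have [cA cA0 hAc] := is_holder_bound g0 hA.
have bA := holder_bound_bmf g0 hAc; have [_ [bd Abd]] := bA.
have B0_le x : `|B0 x| <= bd + 2 * e.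
  rewrite (_ : B0 x = A x - (A x - B0 x)); last by rewrite subKr.
  by rewrite (le_trans (ler_normB _ _))// lerD.
have B0_agree x y : agree N.+2 x y -> B0 x = B0 y.
  move=> xy; rewrite /B0 /stray (follows_agree c xy); congr (_ - _).
  by apply: f_agree => i iN; apply: xy; exact: ltnW.
have B_holder q beta : 0 < beta -> exists b, holder_bound beta (fun x => B0 x - q) b.
  move=> beta0.
  have hB := @holder_bound_agree _ _ lam1 _ _ ne beta B0 N.+2 0 _ beta0 (lexx _) B0_le.
  eexists; apply: holder_boundB (holder_bound_cst _ _); apply: hB => x y xy.
  by rewrite (B0_agree _ _ xy) subrr normr0 mul0r.
have bB0 : bounded_mfun B0.
  have [b hb] := B_holder 0 _ g0; apply: (@holder_bound_bmf _ _ _ _ _ _ gamma _ b g0).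
  by move: hb; under eq_fun do rewrite subr0.
have [p p_le pB] := pressure_normalization bA bB0 AB0_le pA.
have B_le x : `|B0 x - p| <= bd + 2 * e + 2 * e.
  by rewrite (le_trans (ler_normB _ _))// lerD.
have ec0 := excess_const_gt0 c a0.
pose d := eps / 2 / excess_const lam c alpha.
exists (fun x => B0 x - p), d, (@orbit_measure _ _ lam1 _ _ ne _ _ c0); split => //.
- by split; [have [b hb] := B_holder p _ a0|have [b hb] := B_holder p _ g0];
    exact: holder_bound_is_holder hb B_le.
- split=> [x y|x].
    rewrite (_ : _ - _ = (A x - B0 x) - (A y - B0 y)); last by ring.
    exact: AB0_holder.
  rewrite opprB addrA addrAC (le_trans (ler_normD _ _))//.
  rewrite (le_trans (lerD (AB0_le x) p_le))//.
  by lra.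
- by rewrite divr_gt0// divr_gt0.
- move=> A' bA' hd Ad.
  have BE x : B0 x - p = g (word N x) - eps * stray c x + - p by rewrite gE.
  have {}hd : holder_bound alpha
      (fun x => A' x - (g (word N x) - eps * stray c x + - p)) d.
    by move=> x y; rewrite -!BE; exact: hd.
  have {}Ad x : `|A' x - (g (word N x) - eps * stray c x + - p)| <= d.
    by rewrite -BE.
  have d_small : d * excess_const lam c alpha <= eps / 2.
    by rewrite divfK// gt_eqF.
  split; first exact: (locking_maximizing c0 c_uniq c_cycle g_mean g_le a0 eps0 bA' hd Ad d_small).
  exact: (locking_unique c0 c_uniq c_cycle g_mean g_le a0 eps0 bA' hd Ad d_small).
Qed.

End existence.

Theorem theoremC (R : realType) (lam : R) (lam1 : 1 < lam)
    (k : nat) (M : 'M[bool]_k) (ne : admissible M !=set0)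
    (mixing : topologically_mixing (shift : sft lam1 ne -> sft lam1 ne))
    (alpha : R) (alpha0 : 0 < alpha) (alpha1 : alpha <= 1) :
  exists D : set (holder_space lam1 ne alpha),
    [/\ D `<=` C0plus lam1 ne alpha,
        C0plus lam1 ne alpha `<=` closure D &
        forall A, D A -> exists mu : probability (sft lam1 ne) R,
          [/\ maximizing A mu,
              (forall nu, maximizing A nu ->
                 forall B, measurable B -> nu B = mu B) &
              continuously_varying_support A mu]].
Proof.
exists [set A | C0plus lam1 ne alpha A /\
  exists mu : probability (sft lam1 ne) R, [/\ maximizing A mu,
    (forall nu, maximizing A nu -> forall B, measurable B -> nu B = mu B) &
    continuously_varying_support A mu]].
split=> [A []//| |A []//].
move=> A [_ Acl] U /nbhs_ballP[r /= r0 rU].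
have r20 : 0 < r / 2 by rewrite divr_gt0.
have [A1 [[gamma /= /andP[ag g1] [hA1 pA1]] A1r]] := Acl _ (nbhsx_ballx A _ r20).
have [B [d [mu [[hB hBg] pB [AB_holder AB_le] d0 lock]]]] :=
  locked_approximation alpha0 ag (divr_gt0 r0 (ltr0n _ 8)) hA1 pA1.
pose BH : holder_space lam1 ne alpha := exist _ B hB.
(* [A' = BH] gives uniqueness, and the terms of a sequence tending to [BH]
   give the continuity of supports *)
have near_lock (A' : holder_space lam1 ne alpha) : mdist A' BH <= d ->
    maximizing A' mu /\ forall nu, maximizing A' nu ->
      forall D, measurable D -> nu D = mu D.
  move=> A'd; have [h1 h2] := holder_space_mdist alpha0 A' BH.
  apply: lock; first exact: holder_space_bounded_mfun.
    exact: holder_bound_le A'd h1.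
  by move=> x; exact: le_trans (h2 x) A'd.
exists BH; split.
  split.
    split=> //; apply: subset_closure; exists gamma => /=; first by rewrite ag.
    by split.
  have [maxB uniqB] : maximizing BH mu /\ forall nu, maximizing BH nu ->
      forall D, measurable D -> nu D = mu D.
    by apply: near_lock; rewrite mdistxx ltW.
  exists mu; split=> // An _ AnB mun mun_max; apply: eq_strongly_converges.
  have [N _ AnN] : \forall n \near \oo, mdist BH (An n) < d.
    have := AnB (ball BH d) (nbhsx_ballx _ _ d0); rewrite ballEmdist; exact.
  exists N => // n /AnN/= And; apply: (near_lock (An n) _).2 => //.
  by rewrite metric_sym ltW.
apply: rU; rewrite ballEmdist/=.
have A1B : mdist A1 BH <= r / 8 + r / 8.
  by apply: mdist_holder_le => //; rewrite divr_ge0// ltW.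
move: A1r; rewrite ballEmdist/= => A1r.
rewrite (le_lt_trans (metric_triangle _ A1 _))//; lra.
Qed.
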